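(* For every $k\in\mathbb{N}$ (and every integer $n\ge 0$), $$N_{0,k}(n)=\frac{\bar{C}_{k-1}(n)+C_{k-2}(n)}{2},\qquad N_{1,k}(n)=\frac{\bar{C}_{k-1}(n)-C_{k-2}(n)}{2},$$ where by convention $\bar{C}_k(n)=0$ for $k\le 0$.
   Context: A $k$-color partition of $n$ is a finite multiset of positive integers (parts), each carrying one of the $k$ colors $color(1),\dots,color(k)$, whose sum is $n$; repetitions are allowed. $\mathcal{N}_k(n)$ is the set of $k$-color partitions of $n$ in which even parts may occur only in the $k-1$ colors $color(2),\dots,color(k)$ (odd parts may occur in all $k$ colors); the generating function of $|\mathcal{N}_k(n)|$ is $\prod_{j\ge1}(1-q^{2j-1})^{-k}(1-q^{2j})^{-(k-1)}$. $N_{0,k}(n)$ (resp. $N_{1,k}(n)$) is the number of partitions in $\mathcal{N}_k(n)$ in which the number of parts in $color(k)$, counted with multiplicity, is even (resp. odd). $C_k(n)$ is the number of $k$-color partitions of $n$, with generating function $\sum_{n\ge0}C_k(n)q^n=\prod_{j\ge1}(1-q^j)^{-k}$; for the indices $k-2\le 0$ that occur when $k\le 2$, $C_{k-2}(n)$ is read from this generating function. For $k\ge1$, $\bar{C}_k(n)$ is the number of $k$-color partitions of $n$ in which parts in $color(k)$ may be overlined, in the sense of overpartitions: for each part size, the first occurrence of that size in $color(k)$ may or may not be overlined. Thus $\sum_{n\ge0}\bar{C}_k(n)q^n=\prod_{j\ge1}\frac{1+q^j}{(1-q^j)^{k}}$. For $k\le0$ one sets $\bar{C}_k(n)=0$.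
   Formalization: Proved for k ≥ 2 only: at k = 1 the two formulas would add up to C̄_0(n) = 0, while N_{0,1}(n)+N_{1,1}(n) counts partitions of n into odd parts and is at least 1 for every n; at k = 0 there is no color(k). *)

(* Defs.v *)
From mathcomp Require Import all_boot all_order all_algebra.

Set Implicit Arguments.
Unset Strict Implicit.
Unset Printing Implicit Defensive.

Import GRing.Theory Num.Theory.

(* A finite multiset of k-colored positive integers is given by its
   multiplicity function: m (i, c) is the number of parts of size i.+1 in
   color(c.+1).  In a partition of n every part and every multiplicity is at
   most n, so the bounds 'I_n and 'I_n.+1 lose nothing. *)
Notation multiplicity k n := {ffun 'I_n * 'I_k -> 'I_n.+1}.

Definition colored_partitions (k n : nat) : {set multiplicity k n} :=
  [set m : multiplicity k n | \sum_(p : 'I_n * 'I_k) p.1.+1 * m p == n].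

Definition calN (k n : nat) : {set multiplicity k n} :=
  [set m in colored_partitions k n |
     [forall p : 'I_n * 'I_k, ~~ odd p.1.+1 && (0 < m p) ==> (1 < p.2.+1)]].

Definition nb_last_color (k n : nat) (m : multiplicity k n) : nat :=
  \sum_(p : 'I_n * 'I_k | p.2.+1 == k) m p.

Definition N0 (k n : nat) : nat :=
  #|[set m in calN k n | ~~ odd (nb_last_color m)]|.

Definition N1 (k n : nat) : nat :=
  #|[set m in calN k n | odd (nb_last_color m)]|.

(* The second component is the set of those i for which the first occurrence
   of i.+1 in color(k) is overlined; that size must then occur in color(k). *)
Definition overlined_partitions (k n : nat) :
    {set multiplicity k n * {set 'I_n}} :=
  [set mA : multiplicity k n * {set 'I_n} |
     (mA.1 \in colored_partitions k n) &&
     [forall i : 'I_n in mA.2, [exists c : 'I_k, (c.+1 == k) && (0 < mA.1 (i, c))]]].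

Local Open Scope ring_scope.

(* For k <= 0 this is the coefficient of q^n in \prod_(j >= 1) (1 - q^j)^(-k),
   to which the factors with j > n do not contribute. *)
Definition C (k : int) (n : nat) : int :=
  if k <= 0 then (\prod_(1 <= j < n.+1) (1 - 'X^j) ^+ `|k|%N : {poly int})`_n
  else #|colored_partitions `|k|%N n|%:Z.

Definition barC (k : int) (n : nat) : nat :=
  if k <= 0 then 0%N else #|overlined_partitions `|k|%N n|.

(* Main.v *)
(* Weighting a partition by (-1)^(number of parts in color(k)), or by 1, makes
   N0 - N1 and N0 + N1 the coefficients of
     O(q) P(q)^(k-2) / \prod_j (1 + q^j)   and   O(q) P(q)^(k-2) P(q),
   where P = \prod_j 1/(1 - q^j) and O = \prod_(j odd) 1/(1 - q^j) are the series
   of a full color and of color(1).  By Euler's identity O = \prod_j (1 + q^j),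
   so the first is P^(k-2), the series of C_(k-2), and the second is the series
   of overpartitions times P^(k-2), the series of barC_(k-1).  Power series
   are handled as polynomials with coefficients compared up to degree n. *)

Require Import Defs.
From mathcomp Require Import all_boot all_order all_algebra.
From mathcomp Require Import zify ring lra.

Set Implicit Arguments.
Unset Strict Implicit.
Unset Printing Implicit Defensive.

Import GRing.Theory Num.Theory.
Local Open Scope ring_scope.

Section TruncatedSeries.
Variable R : comNzRingType.
Implicit Types (p q : {poly R}) (n : nat).

Definition eqX n p q := forall i, (i <= n)%N -> p`_i = q`_i.

Lemma eqX_refl n p : eqX n p p.
Proof. by []. Qed.

Lemma eqX_sym n p q : eqX n p q -> eqX n q p.
Proof. by move=> pq i /pq. Qed.

Lemma eqX_trans n p q r : eqX n p q -> eqX n q r -> eqX n p r.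
Proof. by move=> pq qr i le_in; rewrite pq ?qr. Qed.

Lemma eqXM n p p' q q' : eqX n p p' -> eqX n q q' -> eqX n (p * q) (p' * q').
Proof.
move=> pp qq i le_in; rewrite !coefM; apply: eq_bigr => j _.
by rewrite pp ?qq //; move: (ltn_ord j); lia.
Qed.

Lemma eqX_prod_nat n a b (P : pred nat) (F G : nat -> {poly R}) :
    (forall j, (a <= j < b)%N -> P j -> eqX n (F j) (G j)) ->
  eqX n (\prod_(a <= j < b | P j) F j) (\prod_(a <= j < b | P j) G j).
Proof.
move=> FG; rewrite big_nat_cond [X in eqX n _ X]big_nat_cond.
elim/big_rec2: _ => // j p q /andP[jab Pj]; apply: eqXM; exact: FG.
Qed.

Lemma eqX_prod_nat1 n a b (P : pred nat) (F : nat -> {poly R}) :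
    (forall j, (a <= j < b)%N -> P j -> eqX n (F j) 1) ->
  eqX n (\prod_(a <= j < b | P j) F j) 1.
Proof. by move/eqX_prod_nat; rewrite big1_eq. Qed.

Lemma eqX_1subXn n j c : (n < j)%N -> eqX n (1 - c *: 'X^j) 1.
Proof.
move=> lt_nj i le_in; rewrite coefB coefZ coefXn.
by rewrite (_ : i == j = false) ?mulr0 ?subr0 //; lia.
Qed.

(* 1 / (1 - c q^j) up to degree n.  Since 0 ^+ 0 = 1, taking c = 0 forbids the
   part j. *)
Definition geom n (c : R) j : {poly R} := \sum_(m < n.+1) c ^+ m *: 'X^(j * m).

Lemma geom0 n j : geom n 0 j = 1.
Proof.
rewrite /geom big_ord_recl big1 => [|i _]; last by rewrite expr0n scale0r.
by rewrite muln0 expr0 scale1r addr0.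
Qed.

Lemma geomM n c j : (0 < j)%N -> eqX n (geom n c j * (1 - c *: 'X^j)) 1.
Proof.
move=> j_gt0; have -> : geom n c j * (1 - c *: 'X^j) =
    1 - c ^+ n.+1 *: 'X^(j * n.+1).
  rewrite exprM -exprZn -[in RHS](expr1n _ n.+1) subrXX mulrC; congr (_ * _).
  by apply: eq_bigr => i _; rewrite expr1n mul1r exprZn exprM.
by apply: eqX_1subXn; nia.
Qed.

Lemma prod_1sub_even m : \prod_(1 <= j < m.+1) (1 - 'X^(j.*2)) =
  \prod_(1 <= j < m.*2.+1 | ~~ odd j) (1 - 'X^j) :> {poly R}.
Proof.
elim: m => [|m IHm]; first by rewrite !big_nil.
rewrite big_nat_recr // IHm /= doubleS [in RHS]big_mkcond /=.
by do 2!rewrite big_nat_recr //=; rewrite odd_double /= mulr1 -big_mkcond.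
Qed.

(* Since (1 + q^j) (1 - q^j) = 1 - q^(2j), multiplying by all 1 - q^j turns
   \prod_j (1 + q^j) into the product of the 1 - q^j with j even. *)
Lemma euler_eqX n :
  eqX n (\prod_(1 <= j < n.+1) geom n (odd j)%:R j)
        (\prod_(1 <= j < n.+1) (1 + 'X^j)).
Proof.
have geo1 j : (1 <= j < n.+1)%N -> eqX n (geom n 1 j * (1 - 'X^j)) 1.
  by case/andP=> j_gt0 _; rewrite -['X^j]scale1r; apply: geomM.
set O := \prod_(_ <= j < _) geom _ _ _; set E := \prod_(_ <= j < _) (1 + _).
pose Q (b : pred nat) := \prod_(1 <= j < n.+1 | b j) (1 - 'X^j) : {poly R}.
pose G (b : pred nat) := \prod_(1 <= j < n.+1 | b j) geom n 1 j.
have GQ b : eqX n (G b * Q b) 1.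
  by rewrite /G /Q -big_split; apply: eqX_prod_nat1 => j jn _; apply: geo1.
have -> : O = G odd.
  rewrite /O /G [RHS]big_mkcond; apply: eq_bigr => j _.
  by case: (odd j); rewrite ?geom0.
(* The even exponents run up to [n.*2] after reindexing; those beyond [n] give factors that are 1 up
   to degree [n]. *)
have EQ : eqX n (E * Q odd * Q (predC odd)) (Q (predC odd)).
  have -> : E * Q odd * Q (predC odd) = \prod_(1 <= j < n.+1) (1 - 'X^(j.*2)).
    rewrite -mulrA /Q -(bigID odd xpredT) /= -big_split; apply: eq_bigr => j _.
    by rewrite -muln2 exprM /=; ring.
  rewrite prod_1sub_even (big_cat_nat _ (n := n.+1)) //=; last by lia.
  rewrite -[X in eqX n _ X]mulr1; apply: eqXM => //.
  apply: eqX_prod_nat1 => j /andP[ltnj _] _.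
  by rewrite -['X^j]scale1r; apply: eqX_1subXn.
(* Cancel [Q (predC odd)] by multiplying with its inverse [G (predC odd)]. Then [E] and [G odd] are
   both inverses of [Q odd], hence agree. *)
have EQ1 : eqX n (E * Q odd) 1.
  apply: eqX_trans (GQ (predC odd)).
  apply: eqX_trans (eqXM (eqX_refl (G (predC odd))) EQ).
  rewrite mulrCA -[X in eqX n X _]mulr1; apply: eqXM => //.
  exact/eqX_sym/GQ.
rewrite -[X in eqX n _ X]mulr1.
apply: eqX_trans (eqXM (eqX_refl E) (GQ odd)).
rewrite mulrCA -[X in eqX n X _]mulr1; apply: eqXM => //; exact: eqX_sym.
Qed.

(** Expanding the product picks one exponent [m i] per factor, that is, a multiplicity function.
    This turns weighted counts of partitions into coefficients. *)
Lemma coef_prod_series n (I : finType) (w : I -> nat) (a : I -> nat -> R) :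
  (\prod_i \sum_(m < n.+1) a i m *: 'X^(w i * m))`_n =
  \sum_(m : {ffun I -> 'I_n.+1} | (\sum_i w i * m i == n)%N) \prod_i a i (m i).
Proof.
rewrite bigA_distr_bigA coef_sum [RHS]big_mkcond; apply: eq_bigr => m _.
rewrite scaler_prod prodrXr coefZ coefXn eq_sym.
by case: eqP => _; rewrite ?mulr1 ?mulr0.
Qed.

End TruncatedSeries.

Lemma prod_colors (R : comNzRingType) n k (F : nat -> 'I_k -> R) :
  \prod_(p : 'I_n * 'I_k) F p.1.+1 p.2 =
  \prod_c \prod_(1 <= j < n.+1) F j c.
Proof.
rewrite -(pair_bigA _ (fun (i : 'I_n) c => F i.+1 c)) exchange_big /=.
by apply: eq_bigr => c _; rewrite big_add1 big_mkord.
Qed.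

Definition color_series n (c : int) : {poly int} :=
  \prod_(1 <= j < n.+1) geom n c j.

Lemma card_colored_partitions k n :
  #|colored_partitions k n|%:Z = (color_series n 1 ^+ k)`_n.
Proof.
rewrite -[k in _ ^+ k]card_ord -prodr_const.
rewrite -(prod_colors _ (fun j _ => geom n 1 j)).
rewrite (coef_prod_series _ (fun p : 'I_n * 'I_k => p.1.+1)
  (fun _ m => 1 ^+ m)).
rewrite -sum1_card -[LHS]natz natr_sum; apply: eq_big => m; first by rewrite inE.
by rewrite big1 // => p _; rewrite expr1n.
Qed.

(** Each part gets a weight by its color: 0 or 1 by parity in the first, [s] in the last, 1 in
    between. With [k.+2] colors the first and last are distinct. *)
Lemma sum_calN k n (s : int) :
  \sum_(m in calN k.+2 n) s ^+ nb_last_color m =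
  (\prod_(1 <= j < n.+1) geom n (odd j)%:R j *
     (color_series n 1 ^+ k * color_series n s))`_n.
Proof.
pose w (j : nat) (c : 'I_k.+2) : int :=
  if c == ord0 then (odd j)%:R else if c == ord_max then s else 1.
have <- : \prod_(p : 'I_n * 'I_k.+2) geom n (w p.1.+1 p.2) p.1.+1 =
    \prod_(1 <= j < n.+1) geom n (odd j)%:R j *
     (color_series n 1 ^+ k * color_series n s).
  rewrite (prod_colors _ (fun j c => geom n (w j c) j)).
  rewrite big_ord_recl big_ord_recr /=; congr (_ * (_ * _)).
    rewrite -[k in RHS]card_ord -prodr_const; apply: eq_bigr => c _.
    apply: eq_bigr => j _; rewrite /w -!val_eqE /= /bump /=.
    by rewrite (_ : (_ == k.+1) = false) //; move: (ltn_ord c); lia.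
  by apply: eq_bigr => j _; rewrite /w -!val_eqE /= eqxx.
rewrite (coef_prod_series _ (fun p : 'I_n * 'I_k.+2 => p.1.+1)
  (fun p m => w p.1.+1 p.2 ^+ m)).
rewrite [RHS](bigID (mem (calN k.+2 n))) /=.
rewrite [X in _ = _ + X]big1 ?addr0 => [|m].
  apply: eq_big => m; first by rewrite !inE; case: eqP.
  rewrite !inE => /andP[_ /forallP mP].
  rewrite -prodrXr big_mkcond; apply: eq_bigr => p _.
  move: (mP p); rewrite /w -!val_eqE /= eqSS; case: (p.2 =P 0%N :> nat) => [->|_].
    (* An even part in the first color has multiplicity 0, and [0 ^+ 0 = 1]. *)
    by case: (odd p.1) => /=; rewrite ?expr1n // lt0n => /negPn/eqP ->.
  by case: eqP => // _ _; rewrite expr1n.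
(* Outside [calN] some even part occurs in the first color; its weight 0 kills the product. *)
rewrite !inE => /andP[-> /= /forallPn[p]].
rewrite negb_imply -leqNgt ltnS leqn0 => /andP[/andP[even_p m_gt0] p0].
by rewrite (bigD1 p) //= /w -val_eqE p0 /= (negPf even_p) expr0n eqn0Ngt m_gt0 mul0r.
Qed.

Lemma sum_calN_sign k n (s : int) : s * s = 1 ->
  \sum_(m in calN k n) s ^+ nb_last_color m = (N0 k n)%:Z + s * (N1 k n)%:Z.
Proof.
move=> ss; have sE m : s ^+ m = if odd m then s else 1.
  by elim: m => // m IHm; rewrite exprS IHm /=; case: odd; rewrite ?mulr1.
rewrite (bigID (fun m => odd (nb_last_color m))) /= addrC.
rewrite -[(N0 k n)%:Z]natz -[(N1 k n)%:Z]natz /N0 /N1.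
rewrite -!sum1_card !natr_sum mulr_sumr; congr (_ + _).
  by apply: eq_big => m; rewrite ?inE // sE => /andP[_ /negPf ->].
by apply: eq_big => m; rewrite ?inE // sE mulr1 => /andP[_ ->].
Qed.

(* The factor of a size j in the last color is 1 + 2 (q^j + q^(2j) + ...):
   an occurring size may be overlined or not. *)
Lemma card_overlined_partitions k n :
  #|overlined_partitions k.+1 n|%:Z =
  (color_series n 1 ^+ k * \prod_(1 <= j < n.+1) (geom n 1 j *+ 2 - 1))`_n.
Proof.
pose w (p : 'I_n * 'I_k.+1) (m : nat) : int :=
  if (p.2 == ord_max) && (0 < m)%N then 2 else 1.
have <- : \prod_(p : 'I_n * 'I_k.+1) \sum_(m < n.+1) w p m *: 'X^(p.1.+1 * m) =
    color_series n 1 ^+ k * \prod_(1 <= j < n.+1) (geom n 1 j *+ 2 - 1).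
  pose F j (c : 'I_k.+1) : {poly int} :=
    if c == ord_max then geom n 1 j *+ 2 - 1 else geom n 1 j.
  transitivity (\prod_(p : 'I_n * 'I_k.+1) F p.1.+1 p.2).
    apply: eq_bigr => -[i c] _; rewrite /F /w /geom /=; case: eqP => _ /=.
      rewrite !big_ord_recl /= muln0 !expr0 !scale1r.
      under eq_bigr do rewrite scaler_nat.
      under [in RHS]eq_bigr do rewrite expr1n scale1r.
      by rewrite sumrMnl; ring.
    by apply: eq_bigr => m _; rewrite expr1n.
  rewrite prod_colors big_ord_recr /=; congr (_ * _).
    rewrite -[k in RHS]card_ord -prodr_const; apply: eq_bigr => c _.
    apply: eq_bigr => j _; rewrite /F -val_eqE /= ifN //.
    by move: (ltn_ord c); lia.
  by apply: eq_bigr => j _; rewrite /F eqxx.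
rewrite (coef_prod_series _ (fun p : 'I_n * 'I_k.+1 => p.1.+1)).
rewrite -sum1_card -[LHS]natz natr_sum.
(* For fixed [m], the admissible overlinings are the subsets of [supp m], so they contribute one
   factor 2 per size occurring in the last color. *)
pose supp (m : multiplicity k.+1 n) := [set i | (0 < m (i, ord_max))%N].
transitivity (\sum_(m in colored_partitions k.+1 n)
    \sum_(A in powerset (supp m)) 1 : int).
  rewrite pair_big_dep /=; apply: eq_bigl => -[m A].
  rewrite !inE /=; congr (_ && _).
  apply/forall_inP/subsetP => suppA i Ai; move: (suppA i Ai); rewrite ?inE.
    by case/existsP=> c /andP[]; rewrite eqSS -[k]/(val (@ord_max k)) val_eqE => /eqP ->.
  by move=> m_gt0; apply/existsP; exists ord_max; rewrite eqxx.
apply: eq_big => m; first by rewrite inE.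
move=> _; rewrite sumr_const card_powerset natrX.
rewrite [RHS](eq_bigr (fun p => w (p.1, p.2) (m (p.1, p.2)))); last by case.
rewrite -(pair_bigA _ (fun i c => w (i, c) (m (i, c)))) /=.
rewrite -prodr_const big_mkcond; apply: eq_bigr => i _.
rewrite inE big_ord_recr big1 /w /= ?eqxx ?mul1r // => c _.
by rewrite -val_eqE /= ifN //; move: (ltn_ord c); lia.
Qed.

(** At [c = -1] the factor [geom n c j] is the inverse of [1 + 'X^j]. *)
Lemma color_series_distinct n :
  eqX n (color_series n (-1) * \prod_(1 <= j < n.+1) (1 + 'X^j)) 1.
Proof.
rewrite -big_split; apply: eqX_prod_nat1 => j /andP[j_gt0 _] _ /=.
by have := geomM (R := int) (n := n) (-1) j_gt0; rewrite scaleN1r opprK.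
Qed.

Lemma overline_series n :
  eqX n (\prod_(1 <= j < n.+1) (geom n 1 j *+ 2 - 1))
        (color_series n 1 * \prod_(1 <= j < n.+1) (1 + 'X^j)).
Proof.
rewrite -big_split; apply: eqX_prod_nat => j /andP[j_gt0 _] _ i le_in /=.
(* This is 2/(1 - x) - 1 = (1 + x)/(1 - x) with x = q^j, read coefficientwise. *)
have := geomM (R := int) (n := n) 1 j_gt0 le_in.
rewrite scale1r mulrBr mulrDr mulr1 mulr2n !coefB !coefD; lra.
Qed.

Theorem theorem1p7 (k n : nat) (hk : (2 <= k)%N) :
  (N0 k n)%:R = ((barC (k%:Z - 1) n)%:R + (C (k%:Z - 2) n)%:~R) / 2 :> rat /\
  (N1 k n)%:R = ((barC (k%:Z - 1) n)%:R - (C (k%:Z - 2) n)%:~R) / 2 :> rat.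
Proof.
case: k hk => [|[|k]] // _.
have -> : C (k.+2%:Z - 2) n = (color_series n 1 ^+ k)`_n.
  rewrite (_ : k.+2%:Z - 2 = k) /C; last by lia.
  (* For two colors the index of [C] is 0, which falls in its product branch with exponent 0. *)
  case: k => [|k] /=; last by rewrite card_colored_partitions.
  by rewrite big1_eq.
have -> : barC (k.+2%:Z - 1) n = #|overlined_partitions k.+1 n|.
  by rewrite (_ : k.+2%:Z - 1 = k.+1) //; lia.
set P := color_series n 1.
have sumN : (N0 k.+2 n)%:Z + (N1 k.+2 n)%:Z = #|overlined_partitions k.+1 n|%:Z.
  rewrite -[(N1 _ _)%:Z]mul1r -sum_calN_sign // sum_calN.
  (* With [P ^+ k] as common factor, only the remaining factors need comparing up to degree [n]. *)
  rewrite card_overlined_partitions mulrCA.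
  apply: (eqXM _ _ (leqnn n)) => //; rewrite mulrC.
  apply: (eqX_trans _ (eqX_sym (@overline_series n))).
  by apply: eqXM => //; apply: euler_eqX.
have diffN : (N0 k.+2 n)%:Z - (N1 k.+2 n)%:Z = (P ^+ k)`_n.
  rewrite -mulN1r -sum_calN_sign // sum_calN mulrCA -[P ^+ k in RHS]mulr1.
  apply: (eqXM _ _ (leqnn n)) => //; rewrite mulrC.
  apply: (eqX_trans _ (@color_series_distinct n)).
  by apply: eqXM => //; apply: euler_eqX.
have intr_nat (m : nat) : m%:R = m%:~R :> rat by [].
rewrite -diffN !intr_nat -sumN intrD intrB; split; lra.
Qed.
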